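(* Let $G$ be a finite $2$-generated nilpotent group. Then $\omega(\Gamma(G)) = \chi(\Gamma(G))$. Moreover, (i) if $G$ is not cyclic, then $\omega(\Gamma(G)) = \chi(\Gamma(G)) = p+1$, where $p$ is the smallest prime such that the Sylow $p$-subgroup of $G$ is not cyclic; (ii) if $G$ is cyclic of order $n$, then $\omega(\Gamma(G)) = \chi(\Gamma(G)) = \phi(n) + \pi(n)$.
   Context: A group is $2$-generated if it can be generated by two elements (cyclic groups are included). The generating graph $\Gamma(G)$ of a finite group $G$ is the simple graph whose vertices are the elements of $G$ and where distinct $g,h \in G$ are adjacent if $G = \langle g,h\rangle$ (no loops, even when $G$ is cyclic). $\omega$ denotes the clique number and $\chi$ the chromatic number of a graph. $\phi$ is the Euler totient function and $\pi(n)$ is the number of distinct prime divisors of $n$. *)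

(* Defs.v *)
From mathcomp Require Import all_boot all_fingroup all_solvable.

Set Implicit Arguments.
Unset Strict Implicit.
Unset Printing Implicit Defensive.

Local Open Scope group_scope.

Record sgraph := SGraph {
  vertex :> finType;
  adj : rel vertex;
  adj_sym : symmetric adj;
  adj_irrefl : irreflexive adj }.

Definition clique (X : sgraph) (A : {set X}) : bool :=
  [forall x in A, forall y in A, (x != y) ==> adj x y].

Definition clique_number (X : sgraph) : nat :=
  \max_(A : {set X} | clique A) #|A|.

Definition colorable (X : sgraph) (k : nat) : bool :=
  [exists f : {ffun X -> 'I_k}, forall x, forall y, adj x y ==> (f x != f y)].

Lemma exists_colorable (X : sgraph) : exists k, colorable X k.
Proof.
exists #|X|; apply/existsP; exists [ffun x => enum_rank x].
apply/forallP => x; apply/forallP => y; apply/implyP => xy.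
rewrite !ffunE (inj_eq enum_rank_inj).
by apply: contraTneq xy => ->; rewrite adj_irrefl.
Qed.

Definition chromatic_number (X : sgraph) : nat := ex_minn (exists_colorable X).

Definition two_generated (gT : finGroupType) (G : {group gT}) : Prop :=
  exists x y : gT, <<[set x; y]>> = G.

Section GeneratingGraph.

Variables (gT : finGroupType) (G : {group gT}).

Definition gen_adj : rel (subg_of G) :=
  fun x y => (x != y) && (<<[set sgval x; sgval y]>> == G).

Lemma gen_adj_sym : symmetric gen_adj.
Proof. by move=> x y; rewrite /gen_adj eq_sym setUC. Qed.

Lemma gen_adj_irrefl : irreflexive gen_adj.
Proof. by move=> x; rewrite /gen_adj eqxx. Qed.

Definition generating_graph : sgraph := SGraph gen_adj_sym gen_adj_irrefl.

End GeneratingGraph.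

Definition noncyclic_Sylow (gT : finGroupType) (G : {group gT}) (p : nat) :
    Prop :=
  prime p /\ exists2 P : {group gT}, p.-Sylow(G) P & ~~ cyclic P.

Definition smallest_noncyclic_Sylow (gT : finGroupType) (G : {group gT})
    (p : nat) : Prop :=
  noncyclic_Sylow G p /\ forall q, noncyclic_Sylow G q -> p <= q.

(* Main.v *)
Require Import Defs.
From mathcomp Require Import all_boot all_fingroup all_solvable.

Set Implicit Arguments.
Unset Strict Implicit.
Unset Printing Implicit Defensive.

Local Open Scope group_scope.

(** In any graph the clique number is at most the chromatic number, so it is
    enough to exhibit a clique and a proper colouring with as many colours as
    the clique has elements ([generating_graph_numbers]). A colouring comes
    from covering the non-generators by proper subgroups: two elements of a
    proper subgroup of G do not generate G.

    If G = <[g]> is cyclic of order n, every non-generator lies in one of the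
    subgroups <[g ^+ p]>, p a prime divisor of n. The clique consists of the
    generators of G and the powers g ^+ p; each generator has its own colour
    and each non-generator is coloured by some g ^+ p whose cycle contains it
    ([cyclic_generating_graph]).

    If G is not cyclic, let p be the smallest prime whose Sylow subgroup P is
    not cyclic. Being nilpotent, G maps onto P, hence onto the Frattini
    quotient E of P, which is elementary abelian, non-cyclic and 2-generated,
    so of order p ^ 2. A pair generating G maps to a pair generating E, so its
    members do not map into a common subgroup of order p; since E has exactly
    p + 1 such subgroups and they cover it, they provide the colouring
    ([noncyclic_Sylow_coloring]).

    For the clique, split G as K x H, with K the Hall subgroup of G for the
    primes smaller than p. All the Sylow subgroups of K are cyclic, so
    K = <[k]> is cyclic. If H = <<[set a; b]>>, then any two of the p + 1
    elements b and a * b ^+ i, i < p, generate H: the only point is that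
    b ^+ (j - i) generates <[b]> when 0 < j - i < p, because #[b] has no prime
    divisor below p. Multiplying each of them by k gives elements which
    pairwise generate K x H, as the orders of k and of elements of H are
    coprime ([smallest_noncyclic_clique]). *)

(** * Cliques and colourings *)

Lemma clique_leq_colors (X : sgraph) (A : {set X}) (k : nat) :
  clique A -> colorable X k -> #|A| <= k.
Proof.
move=> /'forall_in_forall_inP clA /existsP[f /'forall_forallP f_ok].
have injf : {in A &, injective f}.
  move=> x y Ax Ay fxy; apply/eqP/negPn/negP=> nxy.
  have /implyP/(_ nxy) xy := clA x Ax y Ay.
  by have /implyP/(_ xy) := f_ok x y; rewrite fxy eqxx.
by rewrite -(card_in_imset injf) -[k in _ <= k]card_ord max_card.
Qed.

(** Colours may be taken in any finite type, which lets subgroups or elements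
    of a clique serve as colours. *)
Lemma colorable_image (X : sgraph) (T : finType) (C : {set T}) (f : X -> T) :
    (forall x, f x \in C) -> (forall x y, adj x y -> f x != f y) ->
  colorable X #|C|.
Proof.
move=> fC f_ok; apply/existsP; exists [ffun x => enum_rank_in (fC x) (f x)].
apply/'forall_forallP=> x y; apply/implyP=> /f_ok; apply: contraNneq.
by rewrite !ffunE => /(congr1 enum_val); rewrite !enum_rankK_in // => ->.
Qed.

Lemma clique_chromatic_eq (X : sgraph) (A : {set X}) :
    clique A -> colorable X #|A| ->
  clique_number X = #|A| /\ chromatic_number X = #|A|.
Proof.
move=> clA colA; split.
  apply/eqP; rewrite eqn_leq (@leq_bigmax_cond _ _ (fun B : {set X} => #|B|)) //.
  by rewrite andbT; apply/bigmax_leqP=> B clB; apply: clique_leq_colors colA.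
rewrite /chromatic_number; case: ex_minnP => m colm min_m.
by apply/eqP; rewrite eqn_leq min_m // clique_leq_colors.
Qed.

(** The two halves of every computation below: a set A of pairwise generating
    elements and a proper colouring f with #|A| colours pin both invariants. *)
Lemma generating_graph_numbers (gT : finGroupType) (G : {group gT})
    (A : {set gT}) (T : finType) (C : {set T}) (f : gT -> T) :
    A \subset G ->
    {in A &, forall x y, x != y -> <<[set x; y]>> = G} ->
    {in G, forall x, f x \in C} ->
    {in G &, forall x y, x != y -> <<[set x; y]>> = G -> f x != f y} ->
    #|C| = #|A| ->
  clique_number (generating_graph G) = #|A|
  /\ chromatic_number (generating_graph G) = #|A|.
Proof.
move=> sAG genA fC f_ok cardCA.
pose B : {set generating_graph G} := subg G @: A.
have cardB : #|B| = #|A|.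
  apply: card_in_imset => x y /(subsetP sAG) Gx /(subsetP sAG) Gy.
  by move/(congr1 val); rewrite /= !subgK.
rewrite -cardB; apply: clique_chromatic_eq.
  apply/'forall_in_forall_inP=> _ /imsetP[x Ax ->] _ /imsetP[y Ay ->].
  apply/implyP=> nxy; rewrite /= /gen_adj nxy !subgK ?(subsetP sAG) //=.
  by apply/eqP/genA=> //; apply: contraNneq nxy => ->.
rewrite cardB -cardCA.
apply: (@colorable_image (generating_graph G) _ C (fun x => f (sgval x))).
  by move=> x; apply: fC; apply: subgP.
move=> x y /andP[nxy /eqP defG]; apply: f_ok; rewrite ?subgP //.
Qed.

(** * Cyclic groups *)

(** The colouring f is a retraction of G onto a maximum clique: the clique
    itself is the set of colours. *)
Lemma cyclic_generating_graph (gT : finGroupType) (G : {group gT}) :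
  cyclic G ->
  clique_number (generating_graph G) = totient #|G| + size (primes #|G|)
  /\ chromatic_number (generating_graph G)
     = totient #|G| + size (primes #|G|).
Proof.
move=> cycG; have [g defG] := cyclicP cycG.
have Gg : g \in G by rewrite defG cycle_id.
pose gens := [set x | generator G x].
pose Q := [set x in [seq g ^+ p | p <- primes #|G|]].
have dvdG p : p \in primes #|G| -> p %| #|G|.
  by rewrite mem_primes => /and3P[].
have ordQ p : p \in primes #|G| -> #[g ^+ p] = #|G| %/ p.
  by move/dvdG; rewrite defG => /orderXdiv.
have indexQ p : p \in primes #|G| -> #|G : <[g ^+ p]>| = p.
  move=> pG; rewrite -divgS ?cycle_subG ?groupX // -orderE ordQ //.
  by rewrite divnA ?dvdG // mulKn ?cardG_gt0.
have injQ : {in primes #|G| &, injective (fun p => g ^+ p)}.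
  by move=> p q pG qG /= eq_pq; rewrite -(indexQ p) // eq_pq indexQ.
have cardQ : #|Q| = size (primes #|G|).
  rewrite cardsE (card_uniqP _) ?size_map // map_inj_in_uniq //.
  exact: primes_uniq.
have Qproper p : p \in primes #|G| -> ~~ (G \subset <[g ^+ p]>).
  move=> pG; rewrite -indexg_eq1 indexQ //.
  by move: pG; rewrite mem_primes; case: eqP => // ->.
have genP x : x \in gens -> forall y, y \in G -> <<[set x; y]>> = G.
  rewrite inE => /eqP defGx y Gy; apply/eqP; rewrite eqEsubset gen_subG.
  rewrite subUset !sub1set Gy {1 2}defGx cycle_id /=.
  by rewrite genS // subsetUl.
(* The index of <g ^+ p, g ^+ q> divides the distinct primes p and q. *)
have powers_gen p q : p \in primes #|G| -> q \in primes #|G| ->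
    g ^+ p != g ^+ q -> <<[set g ^+ p; g ^+ q]>> = G.
  move=> pG qG npq; set S := <<[set g ^+ p; g ^+ q]>>%G.
  have sSG : S \subset G by rewrite gen_subG subUset !sub1set !groupX.
  have Sp : #|G : S| %| p.
    by rewrite -[X in _ %| X](indexQ p pG) indexgS // cycle_subG mem_gen ?set21.
  have Sq : #|G : S| %| q.
    by rewrite -[X in _ %| X](indexQ q qG) indexgS // cycle_subG mem_gen ?set22.
  apply/eqP; rewrite eqEsubset sSG -indexg_eq1 -dvdn1.
  suff /eqP <- : coprime p q by rewrite dvdn_gcd Sp.
  have [p_pr q_pr] : prime p /\ prime q.
    by move: pG qG; rewrite !mem_primes => /andP[-> _] /andP[->].
  rewrite prime_coprime // dvdn_prime2 //.
  by apply: contraNneq npq => ->.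
(* The generators of G and the elements of Q together form the clique. *)
have disj : [disjoint gens & Q].
  rewrite disjoint_sym; apply/pred0P=> x /=; apply/andP=> -[].
  rewrite !inE => /mapP[p pG ->] /eqP defGx.
  by move: (Qproper p pG); rewrite {1}defGx subxx.
have sAG : gens :|: Q \subset G.
  apply/subsetP=> x; rewrite !inE => /orP[/eqP -> | /mapP[p _ ->]].
    exact: cycle_id.
  exact: groupX.
have cardA : #|gens :|: Q| = totient #|G| + size (primes #|G|).
  rewrite cardsU disjoint_setI0 // cards0 subn0 cardQ.
  have -> : #|G| = #[g] by rewrite defG.
  by rewrite totient_gen -defG.
rewrite -cardA.
(* A non-generator lies in a proper subgroup, hence in one of prime index;
   colour it by the generator of that subgroup that belongs to Q. *)
pose f x := if x \in gens then x else g ^+ pdiv #|G : <[x]>|.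
have nongenP x : x \in G -> x \notin gens ->
    exists2 p, p \in primes #|G| & f x = g ^+ p /\ x \in <[g ^+ p]>.
  move=> Gx ngx; rewrite /f (negPf ngx); set p := pdiv _.
  have sxG : <[x]> \subset G by rewrite cycle_subG.
  have index_gt1 : 1 < #|G : <[x]>|.
    rewrite indexg_gt1; apply: contra ngx => sGx.
    by rewrite inE /generator eqEsubset sGx.
  have pG : p \in primes #|G|.
    rewrite mem_primes pdiv_prime // cardG_gt0.
    exact: dvdn_trans (pdiv_dvd _) (dvdn_indexg _ _).
  exists p => //; split=> //; rewrite -cycle_subG.
  rewrite -(cardSg_cyclic cycG) ?cycle_subG ?groupX // -[#|<[g ^+ p]>|]orderE.
  rewrite (ordQ p pG) (dvdn_divRL _ (dvdG p pG)).
  by rewrite -(Lagrange sxG) dvdn_mul ?pdiv_dvd.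
apply: (@generating_graph_numbers _ G (gens :|: Q) _ (gens :|: Q) f) => //.
- move=> x y Ax Ay nxy.
  have [Gx Gy] := (subsetP sAG x Ax, subsetP sAG y Ay).
  have [gx | ngx] := boolP (x \in gens); first exact: genP.
  have [gy | ngy] := boolP (y \in gens); first by rewrite setUC genP.
  move: Ax Ay nxy; rewrite !in_setU (negPf ngx) (negPf ngy) !inE.
  move=> /mapP[p pG ->] /mapP[q qG ->] npq.
  exact: powers_gen.
- move=> x Gx; rewrite inE; have [gx | ngx] := boolP (x \in gens).
    by rewrite /f gx gx.
  have [p pG [-> _]] := nongenP x Gx ngx.
  by rewrite orbC inE map_f.
have sepf x y : x \in gens -> y \in G -> y \notin gens -> f x != f y.
  move=> gx Gy ngy; have [p pG [-> _]] := nongenP y Gy ngy.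
  rewrite {1}/f gx; apply: contraTneq gx => ->.
  by rewrite (disjointFl disj) // inE map_f.
move=> x y Gx Gy nxy defGxy.
have [gx | ngx] := boolP (x \in gens); have [gy | ngy] := boolP (y \in gens).
- by rewrite /f gx gy.
- exact: sepf.
- by rewrite eq_sym sepf.
have [p pG [-> xp]] := nongenP x Gx ngx; have [q qG [-> yq]] := nongenP y Gy ngy.
apply: contraNneq (Qproper p pG) => eq_pq.
by rewrite -{1}defGxy gen_subG subUset !sub1set xp {1}eq_pq.
Qed.

(** * Colouring by the subgroups of order p of a quotient of order p ^ 2 *)

Lemma pair_gen_quotient (gT : finGroupType) (G N : {group gT}) (x y : gT) :
    G \subset 'N(N) -> <<[set x; y]>> = G ->
  <<[set coset N x; coset N y]>> = G / N.
Proof.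
move=> nNG defG; have sxyG : [set x; y] \subset G by rewrite -defG subset_gen.
rewrite -defG quotient_gen ?(subset_trans sxyG) //.
have [Gx Gy] : x \in G /\ y \in G.
  by rewrite !(subsetP sxyG) // !inE eqxx ?orbT.
by rewrite quotientU !quotient_set1 ?(subsetP nNG).
Qed.

Lemma two_generated_p2Elem (gT : finGroupType) (p : nat) (E : {group gT})
    (x y : gT) :
    p.-abelem E -> ~~ cyclic E -> <<[set x; y]>> = E ->
  E \in 'E_p^2(E).
Proof.
move=> abelE ncE defE; apply/pnElemP; split=> //.
apply/eqP; rewrite eqn_leq [1 < _]ltnNge -(abelem_cyclic abelE) ncE andbT.
rewrite -(rank_abelem abelE) -grank_abelian ?(abelem_abelian abelE) // -defE.
by rewrite (leq_trans (grank_min _)) // cards2; case: (x != y).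
Qed.

(** Each nontrivial element of E is coloured by the subgroup of order p that it
    generates; 1 belongs to all of them, so its colour is arbitrary. Elements
    of one colour lie in that subgroup, hence do not generate E. *)
Lemma p2Elem_coloring (gT : finGroupType) (p : nat) (E : {group gT}) :
    prime p -> E \in 'E_p^2(E) ->
  exists2 f : gT -> {group gT},
    {in E, forall x, f x \in 'E_p^1(E)} &
    {in E &, forall x y, <<[set x; y]>> = E -> f x != f y}.
Proof.
move=> p_pr E2; have [_ abelE dimE] := pnElemP E2.
have ncE : ~~ cyclic E by rewrite (abelem_cyclic abelE) dimE.
have [V0 V0E] : exists V0, V0 \in 'E_p^1(E).
  by apply/card_gt0P; rewrite (card_p1Elem_p2Elem E2).
pose f x : {group gT} := if x == 1 then V0 else <[x]>%G.
have fE : {in E, forall x, f x \in 'E_p^1(E)}.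
  move=> x Ex; rewrite /f; case: eqP => // /eqP ntx.
  rewrite p1ElemE // !inE cycle_subG Ex -orderE.
  by rewrite (abelem_order_p abelE Ex ntx) eqxx.
have f_in x : x \in E -> x \in f x.
  by move=> _; rewrite /f; case: eqP => [-> | _]; rewrite ?group1 ?cycle_id.
exists f => // x y Ex Ey defE; apply: contraNneq ncE => eq_f.
have /pnElemP[sVE _ dimV] := fE x Ex.
rewrite (abelem_cyclic abelE) -dimV dvdn_leq_log ?cardSg //.
by rewrite -defE gen_subG subUset !sub1set {2}eq_f !f_in.
Qed.

(** The quotient of order p ^ 2 is reached in two steps, G / 'O_p^'(G), which is
    isomorphic to the Sylow p-subgroup, and then its Frattini quotient, which
    stays non-cyclic by the Burnside basis theorem. *)
Lemma noncyclic_Sylow_coloring (gT : finGroupType) (G : {group gT}) (p : nat) :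
    two_generated G -> nilpotent G -> noncyclic_Sylow G p ->
  exists (T : finType) (C : {set T}) (f : gT -> T),
    [/\ #|C| = p.+1, {in G, forall x, f x \in C} &
      {in G &, forall x y, <<[set x; y]>> = G -> f x != f y}].
Proof.
move=> [a [b defG]] nilG [p_pr [P sylP ncP]].
set N := 'O_p^'(G)%G; have nNG : G \subset 'N(N) by apply: gFnorm.
set H := (G / N)%G; set M := 'Phi(H)%G.
have nMH : H \subset 'N(M) by apply: gFnorm.
have isoH : 'O_p(G) \isog H.
  apply: sdprod_isog; apply: dprodWsd; rewrite dprodC.
  exact: nilpotent_pcoreC.
have defP : P :=: 'O_p(G) := nilpotent_Hall_pcore nilG sylP.
have ncH : ~~ cyclic H.
  by rewrite -(isog_cyclic isoH) /= -defP.
have pH : p.-group H by rewrite -(isog_pgroup p isoH) pcore_pgroup.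
set E := (H / M)%G; pose u x := coset M (coset N x).
have genE x y : <<[set x; y]>> = G -> <<[set u x; u y]>> = E.
  by move=> defGxy; do 2!apply: pair_gen_quotient => //.
have uE : {in G, forall x, u x \in E}.
  by move=> x Gx; do 2!apply: mem_quotient.
have E2 : E \in 'E_p^2(E).
  apply: two_generated_p2Elem (genE a b defG).
    exact: Phi_quotient_abelem.
  by apply: contra ncH; apply: Phi_quotient_cyclic.
have [f fE f_ok] := p2Elem_coloring p_pr E2.
exists _, 'E_p^1(E), (f \o u); split=> [|x Gx|x y Gx Gy defGxy] /=.
- exact: card_p1Elem_p2Elem E2.
- by apply: fE; apply: uE.
by apply: f_ok; rewrite ?uE ?genE.
Qed.

(** * Pairwise generating elements *)

(** These p + 1 elements lift the points of a projective line: [None] is the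
    point at infinity b, and [Some i] the point with affine coordinate i. *)
Definition power_family (gT : finGroupType) (a b : gT) (p : nat)
  (i : option 'I_p) : gT := if i is Some j then a * b ^+ j else b.

(** From a * b ^+ i and a * b ^+ j one gets b ^+ (j - i), which generates <[b]>
    by the coprimality assumption, and then a. *)
Lemma power_family_gen (gT : finGroupType) (a b : gT) (p : nat) :
    (forall d, 0 < d < p -> coprime #[b] d) ->
  forall i j : option 'I_p, i != j ->
    <<[set a; b]>> \subset <<[set power_family a b i; power_family a b j]>>.
Proof.
move=> cop i j.
have closed (S : {group gT}) m : b \in S -> a * b ^+ m \in S ->
    <<[set a; b]>> \subset S.
  move=> Sb; rewrite groupMr ?groupX // => Sa.
  by rewrite gen_subG subUset !sub1set Sa.
have twoSome (k l : 'I_p) (S : {group gT}) : k < l ->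
    a * b ^+ k \in S -> a * b ^+ l \in S -> <<[set a; b]>> \subset S.
  move=> lt_kl Sk Sl; apply: (closed _ _ _ Sk).
  have : generator <[b]> (b ^+ (l - k)).
    rewrite generator_coprime cop // subn_gt0 lt_kl.
    by rewrite (leq_ltn_trans (leq_subr _ _)).
  move/eqP=> def_b; rewrite -cycle_subG def_b cycle_subG.
  move: Sl; rewrite -(subnKC (ltnW lt_kl)) expgD mulgA groupMl //.
  by rewrite addKn.
have memL (x y : gT) : x \in <<[set x; y]>> by rewrite mem_gen ?set21.
have memR (x y : gT) : y \in <<[set x; y]>> by rewrite mem_gen ?set22.
case: i j => [k|] [l|] nkl /=; last by rewrite eqxx in nkl.
- have: (k : nat) != l by apply: contraNneq nkl => /val_inj->.
  rewrite neq_ltn => /orP[lt_kl|lt_lk].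
    exact: (twoSome _ _ _ lt_kl (memL _ _) (memR _ _)).
  exact: (twoSome _ _ _ lt_lk (memR _ _) (memL _ _)).
- exact: (closed _ _ (memR _ _) (memL _ _)).
exact: (closed _ _ (memL _ _) (memR _ _)).
Qed.

(** Here k is the pi-constituent of k * x, hence one of its powers. *)
Lemma coprime_commuting_gen (gT : finGroupType) (pi : nat_pred)
    (S : {group gT}) (k x : gT) :
    commute k x -> pi.-elt k -> pi^'.-elt x -> k * x \in S ->
  (k \in S) && (x \in S).
Proof.
move=> ckx pik pi'x Skx; have Sk : k \in S.
  have -> : k = (k * x).`_pi.
    by rewrite consttM // (constt_p_elt pik) (constt1P pi'x) mulg1.
  by apply: subsetP (cycle_constt pi (k * x)); rewrite cycle_subG.
by rewrite Sk -(groupMl _ Sk).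
Qed.

(** A nilpotent group whose Sylow subgroups are all cyclic is cyclic. *)
Lemma cyclic_small_pcore (gT : finGroupType) (G : {group gT}) (p : nat) :
    nilpotent G -> (forall q, noncyclic_Sylow G q -> p <= q) ->
  cyclic 'O_[pred q | q < p](G).
Proof.
set pi := [pred q : nat | q < p] => nilG min_p.
have hallK : pi.-Hall(G) 'O_pi(G) := nilpotent_pcore_Hall pi nilG.
apply: nil_Zgroup_cyclic; last exact: nilpotentS (pcore_sub _ _) nilG.
apply/forall_inP=> V /SylowP[q q_pr sylV].
have [pi_q | pi'q] := boolP (q \in pi).
  apply: contraLR (pi_q) => ncV; rewrite inE -leqNgt; apply: min_p.
  by split=> //; exists V => //; apply: subHall_Sylow hallK pi_q sylV.
suff -> : V :=: 1 by apply: cyclic1.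
have pi'V : pi^'.-group V.
  apply: sub_in_pnat (pHall_pgroup sylV) => r _ /eqP->; exact: pi'q.
have piV : pi.-group V := pgroupS (pHall_sub sylV) (pcore_pgroup pi G).
by apply/eqP; rewrite trivg_card1 (pnat_1 piV pi'V).
Qed.

(** The elements of [power_family] for the pi^'-constituents of two generators of
    G, each multiplied by a generator k of the cyclic Hall subgroup for the
    primes below p. The factor k is recovered from any single one of them, so
    the same k can be used throughout. *)
Lemma smallest_noncyclic_clique (gT : finGroupType) (G : {group gT}) (p : nat) :
    two_generated G -> nilpotent G -> ~~ cyclic G ->
    (forall q, noncyclic_Sylow G q -> p <= q) ->
  exists A : {set gT}, [/\ #|A| = p.+1, A \subset G &
    {in A &, forall x y, x != y -> <<[set x; y]>> = G}].
Proof.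
move=> [a [b defG]] nilG ncG min_p; set pi := [pred q : nat | q < p].
have [k defK] := cyclicP (cyclic_small_pcore nilG min_p).
rewrite -/pi in defK.
have [Ga Gb] : a \in G /\ b \in G.
  by rewrite -defG !mem_gen // !inE eqxx ?orbT.
have hall rho := nilpotent_pcore_Hall rho nilG.
have [_ _ cKH _] := dprodP (nilpotent_pcoreC pi nilG).
pose a' := a.`_pi^'; pose b' := b.`_pi^'.
have Hconst x : x \in G -> x.`_pi^' \in 'O_pi^'(G).
  by move=> Gx; rewrite (mem_Hall_pcore (hall _)) ?groupX ?p_elt_constt.
have Kconst x : x \in G -> x.`_pi \in <[k]>.
  by move=> Gx; rewrite -defK (mem_Hall_pcore (hall _)) ?groupX ?p_elt_constt.
have Kk : k \in 'O_pi(G) by rewrite defK cycle_id.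
have pik : pi.-elt k := mem_p_elt (pcore_pgroup _ _) Kk.
pose c (i : option 'I_p) := k * power_family a' b' i.
have [Ha Hb] : a' \in 'O_pi^'(G) /\ b' \in 'O_pi^'(G).
  by split; apply: Hconst.
have Hfam (i : option 'I_p) : power_family a' b' i \in 'O_pi^'(G).
  by case: i => [j|]; [exact: groupM Ha (groupX _ Hb) | exact: Hb].
have cG i : c i \in G.
  rewrite groupM //; first exact: (subsetP (pcore_sub pi G)).
  exact: (subsetP (pcore_sub pi^' G)).
have cop d : 0 < d < p -> coprime #[b'] d.
  case/andP=> d_gt0 lt_dp; rewrite coprime_sym.
  apply: (@pnat_coprime pi); last exact: p_elt_constt.
  apply/pnatP=> // q _ q_d; exact: leq_ltn_trans (dvdn_leq d_gt0 q_d) lt_dp.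
have cgen i j : i != j -> <<[set c i; c j]>> = G.
  move=> nij; apply/eqP; rewrite eqEsubset gen_subG subUset !sub1set !cG /=.
  set S := <<[set c i; c j]>>%G.
  have split_c l : c l \in S -> (k \in S) && (power_family a' b' l \in S).
    have ck : commute k (power_family a' b' l).
      by apply/esym; apply: (centsP cKH).
    have pi'l := mem_p_elt (pcore_pgroup pi^' G) (Hfam l).
    exact: (coprime_commuting_gen ck pik pi'l).
  have /split_c/andP[Sk Si] : c i \in S by rewrite mem_gen ?set21.
  have /split_c/andP[_ Sj] : c j \in S by rewrite mem_gen ?set22.
  have sS : <<[set a'; b']>> \subset S.
    apply: subset_trans (power_family_gen a' cop nij) _.
    by rewrite gen_subG subUset !sub1set Si.
  have SM x : x \in G -> x.`_pi^' \in S -> x \in S.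
    move=> Gx Sx; rewrite -(consttC pi x) groupM //.
    by apply: subsetP (Kconst x Gx); rewrite cycle_subG.
  move: sS; rewrite gen_subG subUset !sub1set => /andP[Sa Sb].
  have : <<[set a; b]>> \subset S.
    by rewrite gen_subG subUset !sub1set (SM a Ga Sa) (SM b Gb Sb).
  by rewrite defG.
(* Equal elements with distinct indices would make G cyclic. *)
have c_inj : injective c.
  move=> i j eq_c; apply/eqP; apply: contraNT ncG => /cgen.
  by rewrite eq_c setUid => <-; apply: cycle_cyclic.
exists (c @: setT); split.
- by rewrite card_imset // cardsT card_option card_ord.
- by apply/subsetP=> _ /imsetP[i _ ->].
move=> _ _ /imsetP[i _ ->] /imsetP[j _ ->] nc.
by apply: cgen; apply: contraNneq nc => ->.
Qed.

(** * Nilpotent groups *)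

Lemma exists_smallest_noncyclic_Sylow (gT : finGroupType) (G : {group gT}) :
  nilpotent G -> ~~ cyclic G -> exists p, smallest_noncyclic_Sylow G p.
Proof.
move=> nilG ncG.
pose bad q := prime q && [exists P : {group gT}, q.-Sylow(G) P && ~~ cyclic P].
have badP q : reflect (noncyclic_Sylow G q) (bad q).
  apply: (iffP andP) => [[q_pr /existsP[P /andP[]]] | [q_pr [P sylP ncP]]].
    by split=> //; exists P.
  by split=> //; apply/existsP; exists P; rewrite sylP.
have ex_bad : exists q, bad q.
  have : ~~ Zgroup G by apply: contra ncG => /nil_Zgroup_cyclic->.
  case/forall_inPn=> P /SylowP[q q_pr sylP] ncP.
  by exists q; apply/badP; split=> //; exists P.
case: (ex_minnP ex_bad) => p /badP bad_p min_p.
by exists p; split=> // q /badP; apply: min_p.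
Qed.

Theorem theorem4 (gT : finGroupType) (G : {group gT}) :
  two_generated G -> nilpotent G ->
  [/\ clique_number (generating_graph G) = chromatic_number (generating_graph G),
      ~~ cyclic G ->
        exists p : nat,
          [/\ smallest_noncyclic_Sylow G p,
              clique_number (generating_graph G) = p.+1
            & chromatic_number (generating_graph G) = p.+1]
    & cyclic G ->
        clique_number (generating_graph G)
          = totient #|G| + size (primes #|G|)
        /\ chromatic_number (generating_graph G)
          = totient #|G| + size (primes #|G|)].
Proof.
move=> genG nilG.
have noncyc : ~~ cyclic G ->
    exists p : nat,
      [/\ smallest_noncyclic_Sylow G p,
          clique_number (generating_graph G) = p.+1
        & chromatic_number (generating_graph G) = p.+1].
  move=> ncG; have [p [ncp min_p]] := exists_smallest_noncyclic_Sylow nilG ncG.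
  have [A [cardA sAG genA]] := smallest_noncyclic_clique genG nilG ncG min_p.
  have [T [C [f [cardC fC f_ok]]]] := noncyclic_Sylow_coloring genG nilG ncp.
  have [||clG chG] := generating_graph_numbers sAG genA fC.
  - by move=> x y Gx Gy _; apply: f_ok.
  - by rewrite cardC.
  by exists p; rewrite -cardA.
split=> //; last exact: cyclic_generating_graph.
have [cycG | /noncyc[p [_ -> ->]] //] := boolP (cyclic G).
by have [-> ->] := cyclic_generating_graph cycG.
Qed.
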